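(* There is a function $f:\mathbb{R}^2\to\{-1,+1\}$, constant in each cell $x+[0,1)^2$, $x\in\mathbb{Z}^2$, such that, for each $\epsilon>0$ and line segment $I$, $$\left|\int_I f\right|\le C_\epsilon\,|I|^{\frac12+\epsilon}.$$ Here $C_\epsilon$ is a constant that depends on $\epsilon$ only.
   Context: Here $I$ is a straight line segment in the plane $\mathbb{R}^2$, $|I|$ denotes its length, and $\int_I f$ is the integral of $f$ over $I$ with respect to length. The function $f$ represents a two-coloring (black/white) of the infinite checkerboard whose cells are the unit squares $x+[0,1)^2$, $x\in\mathbb{Z}^2$, so $\left|\int_I f\right|$ is the absolute difference between the lengths of $I$ in the two colors. The same function $f$ works for all $\epsilon>0$.
   Formalization: For ε > 1/2 the bound is stated only for segments with |I| ≥ 1, since it fails for very short segments inside one cell (there |∫_I f| = |I|); for 0 < ε ≤ 1/2 it is stated for all segments. *)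

(* Defs.v *)
From HB Require Import structures.
From mathcomp Require Import all_boot all_order all_algebra.
From mathcomp Require Import all_classical all_reals all_analysis.
Set Implicit Arguments.
Unset Strict Implicit.
Unset Printing Implicit Defensive.
Import Order.TTheory GRing.Theory Num.Theory.
Import numFieldNormedType.Exports.
Local Open Scope classical_set_scope.
Local Open Scope ring_scope.

Definition cell (R : realType) (x : int * int) : set (R * R) :=
  [set p | x.1%:~R <= p.1 < x.1%:~R + 1 /\ x.2%:~R <= p.2 < x.2%:~R + 1].

Definition checkerboard_coloring (R : realType) (f : R * R -> R) : Prop :=
  (forall p, f p = -1 \/ f p = 1) /\
  (forall (x : int * int) (p q : R * R), cell x p -> cell x q -> f p = f q).

(* A segment is given by its endpoints [a] and [b]. Its length is Euclidean,
   whereas the library norm on [R * R] is the sup norm. *)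
Definition segment_length (R : realType) (a b : R * R) : R :=
  Num.sqrt ((b.1 - a.1) ^+ 2 + (b.2 - a.2) ^+ 2).

(* Integral with respect to length: the affine parametrization of the segment
   by [0, 1] has constant speed [segment_length a b]. *)
Definition segment_integral (R : realType) (f : R * R -> R) (a b : R * R) : R :=
  segment_length a b *
  \int[lebesgue_measure]_(t in `[0%R, 1%R])
     f (a.1 + t * (b.1 - a.1), a.2 + t * (b.2 - a.2)).

(* Main.v *)
(**
  The coloring is built on nested square blocks of sides N_k with
  N_(k+1) = N_k ^ 2: a block of level k+1 is an N_k x N_k array of copies of
  the block of level k, each multiplied by a sign. The number of
  digitized lines x |-> floor (m x + c), |m| <= 1, inside a block of side N is
  polynomial in N. By a Chernoff bound and a union bound, the signs can be chosen so that on each of these lines the sum over the block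
  exceeds the l2-norm of its sub-block sums by a factor of at most
  O(sqrt (log N_(k+1))). Hence the sum along a line with n points in a block
  of level k is at most A_k sqrt n, and A_(k+1) = A_k 2^O(k) is
  N_k^o(1). A line with N_(k-1) < n <= N_k points meets at most four blocks of
  level k, which gives n^(1/2 + eps) in the whole plane.
  For a segment with direction (dx, dy), |dy| <= |dx|, folding the integral
  over the parameter modulo 1/|dx| turns it into an average of sums along
  digitized lines of slope dy/dx.
*)
Require Import Defs.
From HB Require Import structures.
From mathcomp Require Import all_boot all_order all_algebra.
From mathcomp Require Import all_classical all_reals all_analysis.
From mathcomp Require Import measurable_realfun.
From mathcomp Require Import ring lra zify.
Set Implicit Arguments.
Unset Strict Implicit.
Unset Printing Implicit Defensive.
Import Order.TTheory GRing.Theory Num.Theory.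
Import numFieldNormedType.Exports.
Local Open Scope classical_set_scope.
Local Open Scope ring_scope.

(** * Choice of signs *)

Section Signs.
Variable R : realType.
Implicit Types x : R.

(** For [x ^+ 2 <= 1/2], multiply [expR y * (1 - y) <= 1] by [1 + y], for [y = x] and [y = - x], and
    add: the left side times [1 - x ^+ 2] is at most 2. Then use [1 / (1 - u) <= 1 + 2 * u] on
    [[0, 1/2]]. For larger [x], already [|x| <= 2 * x ^+ 2]. *)
Lemma expR_addN_le x : expR x + expR (- x) <= 2 * expR (2 * x ^+ 2).
Proof.
have [x2|x2] := leP (x ^+ 2) 2^-1; last first.
  have h y : y ^+ 2 = x ^+ 2 -> expR y <= expR (2 * x ^+ 2).
    by move=> e; rewrite ler_expR -e; rewrite -e in x2; nra.
  by have := h x erefl; have := h (- x) (sqrrN x); lra.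
have h y : y ^+ 2 = x ^+ 2 -> expR y * (1 - x ^+ 2) <= 1 + y.
  move=> e; have y1 : 0 < 1 - y by rewrite -e in x2; nra.
  have : expR y * (1 - y) <= 1.
    have := expR_ge1Dx (- y); rewrite expRN => h.
    have := expR_gt0 y => p.
    have : expR y * (1 - y) <= expR y * (expR y)^-1 by rewrite ler_pM2l.
    by rewrite divff// gt_eqF.
  move=> k; rewrite -e (_ : 1 - y ^+ 2 = (1 - y) * (1 + y)); last by ring.
  by rewrite mulrA ler_piMl// ; rewrite -e in x2; nra.
have := h x erefl; have := h (- x) (sqrrN x) => h1 h2.
have h3 := expR_ge1Dx (2 * x ^+ 2).
have : (expR x + expR (- x)) * (1 - x ^+ 2) <= 2 by lra.
have := sqr_ge0 x.
set u := x ^+ 2 in x2 h1 h2 h3 *; set c := expR x + _ => u0 hc.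
have c0 : 0 <= c by rewrite addr_ge0 ?expR_ge0.
have : c <= 2 * (1 + 2 * u) by nra.
lra.
Qed.

(** Up to the factor [2 ^ #|I|], the left side is the exponential moment of a sum with independent
    random signs. It factors over the coordinates, and each factor is bounded by [expR_addN_le]. *)
Lemma sum_signs_expR (I : finType) (a : I -> R) :
  \sum_(s : {ffun I -> bool}) expR (\sum_i (-1) ^+ s i * a i)
    <= (2 ^ #|I|)%:R * expR (2 * \sum_i a i ^+ 2).
Proof.
under eq_bigr do rewrite expR_sum.
rewrite -(bigA_distr_bigA (fun i (b : bool) => expR ((-1) ^+ b * a i))).
under eq_bigr => i _.
  rewrite big_bool /= expr1 expr0 mulN1r mul1r.
  over.
rewrite mulr_sumr expR_sum natrX -prodr_const -big_split /=.
apply: ler_prod => i _; rewrite addr_ge0 ?expR_ge0//=.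
by rewrite addrC expR_addN_le.
Qed.

(** Scale each row to l2-norm [L]. The exponential moments, added over all rows and both signs of
    the sum, average at most [2 * #|J| * expR (2 * L ^+ 2) <= expR (3 * L ^+ 2)]. A choice of signs
    not above the average bounds every scaled row sum by [3 * L ^+ 2]; undoing the scaling divides
    by [L]. *)
Lemma exists_signs (I J : finType) (a : J -> I -> R) (L : R) :
  0 < L -> 2 * #|J|%:R <= expR (L ^+ 2) ->
  exists s : I -> bool, forall j,
    `|\sum_i (-1) ^+ s i * a j i| <= 3 * L * Num.sqrt (\sum_i a j i ^+ 2).
Proof.
move=> L0 hL.
pose V j := \sum_i a j i ^+ 2.
have V0 j : 0 <= V j by apply: sumr_ge0 => i _; exact: sqr_ge0.
(* A zero row is sent to zero because [0^-1 = 0]. *)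
pose b j i := a j i / Num.sqrt (V j).
have Vb j : \sum_i (L * b j i) ^+ 2 <= L ^+ 2.
  under eq_bigr do rewrite !exprMn exprVn sqr_sqrtr// mulrA.
  rewrite -mulr_suml -mulr_sumr -/(V j).
  have [->|Vj] := eqVneq (V j) 0; first by rewrite invr0 mulr0 sqr_ge0.
  by rewrite mulfK.
pose S (s : {ffun I -> bool}) j := \sum_i (-1) ^+ s i * (L * b j i).
have tot : \sum_s \sum_j (expR (S s j) + expR (- S s j)) <=
    (2 ^ #|I|)%:R * (2 * #|J|%:R * expR (2 * L ^+ 2)).
  rewrite exchange_big /=.
  set e := expR (2 * L ^+ 2).
  have -> : (2 ^ #|I|)%:R * (2 * #|J|%:R * e) =
      \sum_(j : J) ((2 ^ #|I|)%:R * e + (2 ^ #|I|)%:R * e).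
    by rewrite sumr_const -mulr_natr; ring.
  apply: ler_sum => j _; rewrite big_split /=.
  have h c : (c ^+ 2 = 1) -> \sum_s expR (c * S s j) <=
      (2 ^ #|I|)%:R * e.
    move=> c1; rewrite /S; under eq_bigr => s _.
      rewrite mulr_sumr; under eq_bigr do rewrite mulrCA.
      over.
    apply: le_trans (sum_signs_expR _) _; rewrite ler_wpM2l// ler_expR ler_pM2l//.
    by under eq_bigr do rewrite exprMn c1 mul1r.
  rewrite lerD//.
    rewrite (eq_bigr (fun s => expR (1 * S s j))); first exact/h/expr1n.
    by move=> s _; rewrite mul1r.
  rewrite (eq_bigr (fun s => expR (-1 * S s j))).
    by apply: h; rewrite sqrrN expr1n.
  by move=> s _; rewrite mulN1r.
have [s hs] : exists s, \sum_j (expR (S s j) + expR (- S s j)) <=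
    2 * #|J|%:R * expR (2 * L ^+ 2).
  apply: contrapT => h.
  have : (2 ^ #|I|)%:R * (2 * #|J|%:R * expR (2 * L ^+ 2)) <
      \sum_s \sum_j (expR (S s j) + expR (- S s j)).
    rewrite -{1}card_bool -card_ffun mulr_natl -sumr_const.
    apply: ltr_sum => [|s _]; last by rewrite ltNge; apply/negP => k; apply: h; exists s.
    by apply/hasP; exists [ffun=> true]; rewrite ?mem_index_enum.
  by rewrite ltNge tot.
exists s => j.
have e3 : expR (3 * L ^+ 2) = expR (L ^+ 2) * expR (2 * L ^+ 2).
  by rewrite -expRD; congr expR; ring.
have hj : expR `|S s j| <= expR (3 * L ^+ 2).
  rewrite e3; apply: (@le_trans _ _ (expR (S s j) + expR (- S s j))).
    by case: (ger0P (S s j)) => _; rewrite ?lerDl ?lerDr expR_ge0.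
  apply: (le_trans _ (le_trans hs _)).
    rewrite [leRHS](bigD1 j)//= lerDl; apply: sumr_ge0 => i _.
    by rewrite addr_ge0 ?expR_ge0.
  by rewrite ler_wpM2r ?expR_ge0.
rewrite ler_expR in hj.
have aE i : a j i = Num.sqrt (V j) * b j i.
  rewrite /b mulrCA; have [Vj|Vj] := eqVneq (V j) 0; last first.
    by rewrite divff ?mulr1// sqrtr_eq0 -ltNge lt_neqAle eq_sym Vj V0.
  rewrite Vj sqrtr0 mul0r mulr0; apply/eqP; rewrite -sqrf_eq0.
  by move/eqP: Vj; rewrite psumr_eq0;
    [move/allP/(_ i); rewrite mem_index_enum; exact | move=> k _; exact: sqr_ge0].
have -> : \sum_i (-1) ^+ s i * a j i = Num.sqrt (V j) / L * S s j.
  rewrite mulr_sumr; apply: eq_bigr => i _; rewrite aE.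
  by field; rewrite gt_eqF.
rewrite normrM ger0_norm ?divr_ge0 ?sqrtr_ge0 ?(ltW L0)// -/(V j).
rewrite mulrAC ler_pdivrMr//.
have := ler_wpM2l (sqrtr_ge0 (V j)) hj.
by lra.
Qed.

End Signs.

(** * Digitized lines *)

Section Digital.
Variable R : realType.

Definition digital_line (m c : R) (p q x y : int) : bool :=
  (p <= x < q) && (y == Num.floor (m * x%:~R + c)).

Definition digital (D : int -> int -> bool) : Prop :=
  exists m c p q, `|m| <= 1 /\
    ((D =2 digital_line m c p q) \/ (D =2 fun x y => digital_line m c p q y x)).

Lemma digital_translate D (s t : int) :
  digital D -> digital (fun x y => D (s + x) (t + y)).
Proof.
have key m c p q (a b x y : int) : digital_line m c p q (a + x) (b + y) =
    digital_line m (c + m * a%:~R - b%:~R) (p - a) (q - a) x y.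
  rewrite /digital_line; congr andb; first by apply/idP/idP => h; lia.
  rewrite ![_ == Num.floor _]eq_sym !floor_eq !intrD; apply/idP/idP => h; lra.
move=> [m [c [p [q [m1 [h|h]]]]]]; do 4 eexists; split; try exact: m1.
  by left => x y; rewrite h key.
by right => x y; rewrite h key.
Qed.

Lemma floor_eqE (y : int) (z : R) :
  (y == Num.floor z) = (y%:~R <= z) && ~~ ((y + 1)%:~R <= z).
Proof. by rewrite eq_sym floor_eq -ltNge. Qed.

(** This decides [w <= m * d] from [k / d0] alone. For [d < 0] it asks whether [m] is at most the
    fraction [- w / |d|], which must then exceed [k / d0] strictly when [k / d0 < m]. *)
Definition le_fraction (k d0 : int) (b : bool) (w d : int) : bool :=
  if b && (d < 0) then w * d0 < k * d else w * d0 <= k * d.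

(* Among the fractions with denominators at most [N], [k / d0] is the largest
   one not exceeding [m]; [b] records whether it is smaller than [m]. *)
Lemma slope_fraction (m : R) (N : nat) : `|m| <= 1 -> (0 < N)%N ->
  exists (k : int) (d0 : nat) (b : bool),
    [/\ `|k| <= N%:Z, (0 < d0 <= N)%N &
     forall w d : int, `|d| <= N%:Z ->
       (w%:~R <= m * d%:~R) = le_fraction k d0 b w d].
Proof.
move=> m1 N0.
(* For each denominator [i.+1] this is the largest fraction not exceeding [m]. *)
pose F (i : 'I_N) : R := (Num.floor (m * i.+1%:R))%:~R / i.+1%:R.
have [i0 _ hmax'] := @arg_maxP _ _ _ (Ordinal N0) predT F isT.
have hmax i : F i <= F i0 := hmax' i isT.
set k := Num.floor (m * i0.+1%:R).
have i1 : (0 : R) < i0.+1%:R by rewrite ltr0n.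
exists k, i0.+1, (k%:~R / i0.+1%:R < m); split.
- have := floor_itv (m * i0.+1%:R); rewrite -/k => /andP[k1 k2].
  rewrite ler_norml in m1; case/andP: m1 => m1 m2.
  have h1 : k%:~R <= (i0.+1)%:~R :> R by apply: le_trans k1 _; rewrite -[leRHS]mul1r ler_wpM2r// ltW.
  have h2 : (- (i0.+1)%:Z)%:~R < (k + 1)%:~R :> R.
    by apply: le_lt_trans k2; rewrite intrN -mulN1r ler_wpM2r// ltW.
  move: h1 h2; rewrite ler_int ltr_int => h1 h2.
  by have := ltn_ord i0; lia.
- by rewrite /= ltn_ord.
have r_le : k%:~R / i0.+1%:R <= m by rewrite ler_pdivrMr// floor_le.
have r_max (w : int) (e : nat) : (0 < e <= N)%N -> w%:~R <= m * e%:R :> R ->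
    w%:~R / e%:R <= k%:~R / i0.+1%:R :> R.
  case: e => // e /= eN h; have := hmax (Ordinal eN); rewrite /F /= -/k; apply: le_trans.
  by rewrite ler_pM2r ?invr_gt0 ?ltr0n// ler_int floor_ge_int.
move=> w d dN; rewrite /le_fraction.
have lecross (e : nat) : (w * i0.+1%:Z <= k * e%:Z) =
   (w%:~R * i0.+1%:R <= k%:~R * e%:R :> R).
  by rewrite -(ler_int R) !intrM.
case: d dN => [[|e]|e] dN.
- rewrite ltxx andbF !mulr0 lerz0 pmulr_lle0//.
- rewrite (_ : (e.+1%:Z < 0) = false)// andbF lecross.
  have e0 : (0 : R) < e.+1%:R by rewrite ltr0n.
  apply/idP/idP => h.
    have := r_max w e.+1 _ h; rewrite ler_pdivrMr// mulrAC ler_pdivlMr//; apply.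
    by lia.
  by move: r_le; rewrite ler_pdivrMr// => r_le; nra.
- rewrite NegzE; have -> : (- e.+1%:Z < 0) by lia.
  have e0 : (0 : R) < e.+1%:R by rewrite ltr0n.
  rewrite andbT; have := r_le; rewrite le_eqVlt; case: ltrP => [rm _|rm].
    have lt1 : (w * i0.+1%:Z < k * - e.+1%:Z) =
       (w%:~R * i0.+1%:R < - (k%:~R * e.+1%:R) :> R).
      by rewrite mulrN -(ltr_int R) intrN !intrM.
    rewrite lt1 intrN mulrN.
    rewrite ltr_pdivrMr// in rm.
    apply/idP/idP => h; first by nra.
    rewrite leNgt; apply/negP => hh.
    (* If the inequality failed, [- w / e.+1] would be below [m], hence at most [k / d0], against
       [h]. *)
    have := r_max (- w) e.+1.
    rewrite intrN; move=> /(_ _ _); rewrite ler_pdivrMr// mulrAC ler_pdivlMr//.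
    have -> : (- w%:~R <= m * e.+1%:R) by lra.
    have -> : (0 < e.+1 <= N)%N by lia.
    by move=> /(_ isT isT); lra.
  rewrite orbF => /eqP <-.
  have -> : (w * i0.+1%:Z <= k * - e.+1%:Z) =
       (w%:~R * i0.+1%:R <= - (k%:~R * e.+1%:R) :> R).
    by rewrite mulrN -(ler_int R) intrN !intrM.
  rewrite intrN mulrN.
  have -> : k%:~R / i0.+1%:R * e.+1%:R = (k%:~R * e.+1%:R) / i0.+1%:R :> R.
    by rewrite mulrAC.
  by rewrite -[- (_ / _)]mulNr ler_pdivlMr.
Qed.

(* [x0] maximizes [floor (m x + c) - m x] on [[0, N)]: the line is lowered
   until it passes through a lattice point, without changing the floors. *)
Lemma intercept_lattice (m c : R) (N : nat) : (0 < N)%N ->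
  exists2 x0 : nat, (x0 < N)%N &
    forall y0 : int, y0 = Num.floor (m * x0%:R + c) ->
    forall (x : nat) (y : int), (x < N)%N ->
      (y%:~R <= m * x%:R + c) = ((y - y0)%:~R <= m * (x%:Z - x0%:Z)%:~R).
Proof.
move=> N0.
pose F (i : 'I_N) : R := (Num.floor (m * i%:R + c))%:~R - m * i%:R.
have [i0 _ hmax'] := @arg_maxP _ _ _ (Ordinal N0) predT F isT.
have hmax i : F i <= F i0 := hmax' i isT.
exists i0 => // _ -> x y xN.
have h1 := floor_le (m * i0%:R + c).
have h2 := hmax (Ordinal xN); rewrite /F /= in h2.
set y0 := Num.floor (m * i0%:R + c) in h1 h2 *.
rewrite !intrD !intrN; apply/idP/idP => h; last by rewrite -!pmulrn in h *; lra.
move: h; rewrite -floor_ge_int => h.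
have : y%:~R <= (Num.floor (m * x%:R + c))%:~R :> R by rewrite ler_int.
by rewrite -!pmulrn; lra.
Qed.

(** By [slope_fraction] and [intercept_lattice], the trace of a line on the square is determined by
    six integers of size [O(N)] and two booleans: the strictness flag and the choice of axis. *)
Lemma digital_family (N : nat) : (0 < N)%N ->
  exists (J : finType) (E : J -> int -> int -> bool),
    (#|J| <= 4 * (4 * N) ^ 6)%N /\
    forall D, digital D -> exists j, forall u v : nat, (u < N)%N -> (v < N)%N ->
      D u v = E j u v.
Proof.
move=> N0; pose I := 'I_(4 * N).
(* [y0] and [k] range over intervals containing negative integers: they are
   stored shifted by [N]. *)
pose line (b : bool) (z : I * I * I * I * I * I) (x y : int) : bool :=
  let: (p, q, x0, y0, d, k) := z in
  [&& (p%:Z <= x), x < q%:Z,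
    le_fraction (k%:Z - N%:Z) d b (y - (y0%:Z - N%:Z)) (x - x0%:Z) &
    ~~ le_fraction (k%:Z - N%:Z) d b (y - (y0%:Z - N%:Z) + 1) (x - x0%:Z)].
exists (bool * bool * (I * I * I * I * I * I))%type,
  (fun j x y => if j.1.1 then line j.1.2 j.2 y x else line j.1.2 j.2 x y).
split.
  by rewrite !card_prod !card_bool !card_ord !expnS expn0; lia.
have K0 : (0 < 4 * N)%N by lia.
pose o := Ordinal K0.
have key m c p q : `|m| <= 1 -> exists b z, forall u v : nat,
    (u < N)%N -> (v < N)%N -> digital_line m c p q u v = line b z u v.
  move=> m1.
  have [[[u1 u1N] [[v1 v1N] h1]]|hno] := pselect (exists u v : 'I_N,
    digital_line m c p q u v); last first.
    (* A line that misses the square is encoded by the empty range [[0, 0)]. *)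
    exists true, (o, o, o, o, o, o) => u v uN vN.
    have -> : line true (o, o, o, o, o, o) u v = false.
      by apply/negP => /and4P[_ /= hu _ _]; lia.
    by apply/negP => h; apply: hno; exists (Ordinal uN), (Ordinal vN).
  have [k [d [b [kN dN hk]]]] := slope_fraction m1 N0.
  have [x0 x0N /(_ _ erefl) hx0] := intercept_lattice m c N0.
  set y0 := Num.floor (m * x0%:R + c) in hx0.
  (* The line meets the square at abscissa [u1]; going from there to [x0] changes the height by at
     most [N], since the slope is at most 1 in absolute value. *)
  have /andP[y0l y0u] : - N%:Z <= y0 <= 2 * N%:Z.
    move: h1 => /andP[_]; rewrite /= floor_eqE -ltNge => /andP[ha hb].
    have := floor_itv (m * x0%:R + c); rewrite -/y0 => /andP[hc hd].
    have mx (a b0 : nat) : (a < N)%N -> (b0 < N)%N -> m * a%:R - m * b0%:R <= N%:R.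
      move=> aN bN; rewrite -mulrBr; apply: le_trans (ler_norm _) _.
      rewrite normrM; apply: (@le_trans _ _ `|a%:R - b0%:R|).
        by rewrite -[leRHS]mul1r ler_wpM2r.
      have : a%:R <= N%:R :> R by rewrite ler_nat ltnW.
      have : b0%:R <= N%:R :> R by rewrite ler_nat ltnW.
      have := ler0n R a; have := ler0n R b0.
      by rewrite ler_norml; lra.
    have e1 := mx _ _ x0N u1N; have e2 := mx _ _ u1N x0N.
    have v1N' : v1%:R + 1 <= N%:R :> R by rewrite natr1 ler_nat.
    have v10 := ler0n R v1.
    rewrite !intrD -!pmulrn in ha hb hd.
    have l1 : (- N%:Z)%:~R < (y0 + 1)%:~R :> R.
      by rewrite intrN intrD -!pmulrn; lra.
    have l2 : y0%:~R < (2 * N%:Z)%:~R :> R by rewrite intrM -!pmulrn; lra.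
    by move: l1 l2; rewrite !ltr_int; lia.
  (* Only the trace of [[p, q)] on [[0, N)] matters. *)
  pose clamp (p : int) : nat := if p < 0 then 0%N else minn `|p| N.
  have cl r : (clamp r < 4 * N)%N by rewrite /clamp; case: ifP; lia.
  have y0' : (absz (y0 + N%:Z)%R < 4 * N)%N by lia.
  have x0' : (x0 < 4 * N)%N by lia.
  have d' : (d < 4 * N)%N by lia.
  have k' : (absz (k + N%:Z)%R < 4 * N)%N by lia.
  exists b, (Ordinal (cl p), Ordinal (cl q), Ordinal x0', Ordinal y0', Ordinal d',
    Ordinal k') => u v uN vN.
  rewrite /digital_line /line /= floor_eqE (hx0 u v)// (hx0 u (v + 1)%R)//.
  have -> : (absz (k + N%:Z))%:Z - N%:Z = k by lia.
  have -> : (absz (y0 + N%:Z))%:Z - N%:Z = y0 by lia.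
  have ux : `|u%:Z - x0%:Z| <= N%:Z by lia.
  rewrite addrAC !hk// -!andbA; congr andb; last congr andb.
    by rewrite /clamp; case: ifP; lia.
  by rewrite /clamp; case: ifP; lia.
move=> D [m [c [p [q [m1 h]]]]].
have [b [z hz]] := key m c p q m1.
case: h => h.
  by exists (false, b, z) => u v uN vN; rewrite h hz.
by exists (true, b, z) => u v uN vN; rewrite h hz.
Qed.

End Digital.

(** * Hierarchical coloring *)

Section Substitution.
Variable R : realType.

Lemma sum_ord_mul (V : nmodType) (n k : nat) (F : nat -> V) :
  \sum_(x < n * k) F x = \sum_(i < n) \sum_(j < k) F (i * k + j)%N.
Proof.
rewrite -(big_mkord predT F) big_nat_mul big_mkord; apply: eq_bigr => i _.
rewrite mulSn -{1}[(i * k)%N]add0n big_addn addnK big_mkord.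
by apply: eq_bigr => j _; rewrite addnC.
Qed.

Definition balanced (N : nat) (A : R) (g : nat -> nat -> bool) : Prop :=
  forall D, digital R D ->
    `|\sum_(u < N) \sum_(v < N) (D u v)%:R * (-1) ^+ g u v| <=
      A * Num.sqrt (\sum_(u < N) \sum_(v < N) (D u v)%:R).

Definition substitute (N : nat) (s g : nat -> nat -> bool) (x y : nat) : bool :=
  s (x %/ N)%N (y %/ N)%N (+) g (x %% N)%N (y %% N)%N.

Lemma substituteE N s g U V u v : (u < N)%N -> (v < N)%N ->
  substitute N s g (U * N + u) (V * N + v) = s U V (+) g u v.
Proof.
move=> uN vN; have N0 : (0 < N)%N by exact: leq_ltn_trans uN.
by rewrite /substitute !divnMDl// !modnMDl !divn_small// !modn_small// !addn0.
Qed.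

(** Apply [exists_signs] to the vectors of sub-block sums of the lines in [digital_family]. By
    hypothesis the square of a sub-block sum is at most [A ^+ 2] times the number of points there,
    and these numbers add up over the sub-blocks. The sign at [(1, 1)] is fixed so that the larger
    pattern extends the smaller one. *)
Lemma balanced_substitute (N : nat) (A L : R) (g : nat -> nat -> bool) :
  (0 < N)%N -> 0 <= A -> 0 < L ->
  (8 * (4 * (N * N)) ^ 6)%N%:R <= expR (L ^+ 2) ->
  balanced N A g ->
  exists2 s : nat -> nat -> bool, s 1%N 1%N = false &
    balanced (N * N) (A * (3 * L)) (substitute N s g).
Proof.
move=> N0 A0 L0 hL hg.
have NN0 : (0 < N * N)%N by rewrite muln_gt0 N0.
have [J [E [cardJ hE]]] := digital_family R NN0.
have split2 (F : nat -> nat -> R) : \sum_(x < N * N) \sum_(y < N * N) F x y =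
    \sum_(i : 'I_N * 'I_N) \sum_(u < N) \sum_(v < N)
      F (i.1 * N + u)%N (i.2 * N + v)%N.
  rewrite (sum_ord_mul _ _ (fun x => \sum_(y < N * N) F x y)).
  rewrite -(pair_bigA _ (fun U V : 'I_N => \sum_(u < N) \sum_(v < N)
      F (U * N + u)%N (V * N + v)%N)).
  apply: eq_bigr => U _; rewrite [RHS]exchange_big /=; apply: eq_bigr => u _.
  exact: sum_ord_mul.
pose a (j : J) (i : 'I_N * 'I_N) : R := \sum_(u < N) \sum_(v < N)
  (E j (i.1 * N + u)%N (i.2 * N + v)%N)%:R * (-1) ^+ g u v.
have [|s hs] := exists_signs a L0.
  apply: le_trans hL; rewrite -natrM ler_nat; lia.
(* Flipping all signs together preserves the bound and normalizes the sign at [(1, 1)]. *)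
pose b := if insub 1%N is Some o then s (o, o) else false.
pose s' U V := if insub U is Some i then
  if insub V is Some j then b (+) s (i, j) else false else false.
exists s'.
  by rewrite /s' /b; case: insub => // o; rewrite addbb.
move=> D dD; have [j hj] := hE D dD.
rewrite (split2 (fun x y => (D x y)%:R * (-1) ^+ substitute N s' g x y)).
rewrite (split2 (fun x y => (D x y)%:R)).
have inN (U u : 'I_N) : (U * N + u < N * N)%N.
  by have := ltn_ord U; have := ltn_ord u; nia.
have -> : \sum_(i : 'I_N * 'I_N) \sum_(u < N) \sum_(v < N)
     (D (i.1 * N + u)%N (i.2 * N + v)%N)%:R *
       (-1) ^+ substitute N s' g
        (i.1 * N + u) (i.2 * N + v) =
    (-1) ^+ b * \sum_i (-1) ^+ s i * a j i.
  rewrite mulr_sumr; apply: eq_bigr => -[U V] _ /=.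
  rewrite mulrA -signr_addb mulr_sumr; apply: eq_bigr => u _.
  rewrite mulr_sumr; apply: eq_bigr => v _.
  by rewrite substituteE// /s' !valK hj ?inN// [in LHS]signr_addb mulrCA.
rewrite normrM normr_sign mul1r; apply: le_trans (hs j) _.
rewrite mulrC [A * _]mulrC -[leRHS]mulrA [leRHS]mulrC.
rewrite ler_wpM2r//; first by rewrite mulr_ge0// ltW.
have -> : A * Num.sqrt (\sum_(i : 'I_N * 'I_N) \sum_(u < N) \sum_(v < N)
     (D (i.1 * N + u)%N (i.2 * N + v)%N)%:R) =
  Num.sqrt (A ^+ 2 * (\sum_(i : 'I_N * 'I_N) \sum_(u < N) \sum_(v < N)
     (D (i.1 * N + u)%N (i.2 * N + v)%N)%:R)).
  by rewrite sqrtrM ?sqr_ge0// sqrtr_sqr ger0_norm.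
apply: ler_wsqrtr; rewrite mulr_sumr; apply: ler_sum => -[U V] _ /=.
have := hg _ (digital_translate (U * N)%N%:Z (V * N)%N%:Z dD) => h.
have -> : a j (U, V) = \sum_(u < N) \sum_(v < N)
    (D ((U * N)%N%:Z + u) ((V * N)%N%:Z + v))%:R * (-1) ^+ g u v.
  apply: eq_bigr => u _; apply: eq_bigr => v _.
  by rewrite -!PoszD hj ?inN.
rewrite -real_normK ?num_real//.
rewrite (le_trans (lerXn2r 2 _ _ h)) ?nnegrE//.
  by rewrite mulr_ge0 ?sqrtr_ge0.
rewrite exprMn sqr_sqrtr//.
by apply: sumr_ge0 => u _; apply: sumr_ge0.
Qed.

End Substitution.

(** * Iteration of the substitution *)

Section Tower.
Variable R : realType.

(** The sides square at each step. With at least 4 sub-blocks per row, the sub-block [(1, 1)] stays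
    off the border, so the central blocks below grow in all four directions. *)
Definition side (k : nat) : nat := (4 ^ (2 ^ k))%N.

(* The factor gained at step [k] is [3 * (7 * 2 ^+ k)]: there are at most
   [expR ((7 * 2 ^+ k) ^+ 2)] digital lines to control in a block of side
   [side k.+1] (see [family_bound]). *)
Definition amplitude (k : nat) : R := 4 * \prod_(j < k) (21 * 2 ^+ j).

Lemma side_gt0 k : (0 < side k)%N.
Proof. by rewrite expn_gt0. Qed.

Lemma sideS k : side k.+1 = (side k * side k)%N.
Proof. by rewrite /side expnS mul2n -addnn expnD. Qed.

Lemma side_ge4 k : (4 <= side k)%N.
Proof. by rewrite -{1}(expn1 4) leq_exp2l// expn_gt0. Qed.

Lemma amplitude_ge0 k : 0 <= amplitude k.
Proof. by rewrite mulr_ge0// prodr_ge0// => i _; rewrite mulr_ge0// exprn_ge0. Qed.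

Lemma amplitudeS k : amplitude k.+1 = amplitude k * (3 * (7 * 2 ^+ k)).
Proof. by rewrite /amplitude big_ord_recr /=; ring. Qed.

(** The sum [S] counts at most 16 cells, so [S <= 4 * sqrt S]; this is the 4 in [amplitude]. *)
Lemma balanced0 : balanced (side 0) (amplitude 0) (fun _ _ => false).
Proof.
move=> D _; rewrite /amplitude big_ord0 mulr1 /side expn0 expn1.
under eq_bigr do under eq_bigr do rewrite expr0 mulr1.
set S := \sum_(u < 4) _.
have S0 : 0 <= S by apply: sumr_ge0 => u _; apply: sumr_ge0.
have S16 : S <= 16.
  apply: (@le_trans _ _ (\sum_(u < 4) \sum_(v < 4) 1)).
    by apply: ler_sum => u _; apply: ler_sum => v _; case: (D u v).
  by rewrite !sumr_const !card_ord -mulrnA.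
rewrite ger0_norm//.
have e : S = Num.sqrt S ^+ 2 by rewrite sqr_sqrtr.
have h : Num.sqrt S <= 4.
  have -> : 4 = Num.sqrt (4 ^+ 2) :> R by rewrite sqrtr_sqr ger0_norm.
  by apply: ler_wsqrtr; lra.
have := sqrtr_ge0 S.
by rewrite {2}e; nra.
Qed.

Lemma family_bound k : (8 * (4 * (side k * side k)) ^ 6)%N%:R <= expR ((7 * 2 ^+ k) ^+ 2) :> R.
Proof.
have -> : (8 * (4 * (side k * side k)) ^ 6 = 2 ^ (15 + 24 * 2 ^ k))%N.
  have -> : side k = (2 ^ (2 * 2 ^ k))%N by rewrite expnM.
  rewrite -[8%N]/(2 ^ 3)%N -[4%N]/(2 ^ 2)%N -!expnD -expnM -expnD.
  by congr (_ ^ _)%N; lia.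
(* Here [2 <= e], and [15 + 24 * t <= 49 * t ^ 2] for [t = 2 ^ k >= 1]. *)
apply: (@le_trans _ _ (expR 1 ^+ (15 + 24 * 2 ^ k))).
  rewrite natrX lerXn2r// ?nnegrE ?expR_ge0//.
  by have := expR_ge1Dx (1 : R); lra.
rewrite -expRM_natl ler_expR mulr1 natrD natrM natrX.
have : 1 <= 2 ^+ k :> R by rewrite exprn_ege1// ler1n.
by nra.
Qed.

Lemma exists_tower : exists g : nat -> nat -> nat -> bool,
  (forall k, balanced (side k) (amplitude k) (g k)) /\
  (forall k, exists2 s, s 1%N 1%N = false & g k.+1 = substitute (side k) s (g k)).
Proof.
(* The successor function is total on pairs (level, pattern); an unbalanced pattern is its own
   successor. *)
have /choice[F hF] : forall z : nat * (nat -> nat -> bool), exists h,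
    balanced (side z.1) (amplitude z.1) z.2 ->
      balanced (side z.1.+1) (amplitude z.1.+1) h /\
      exists2 s, s 1%N 1%N = false & h = substitute (side z.1) s z.2.
  move=> [k h] /=.
  have [hb|] := pselect (balanced (side k) (amplitude k) h); last by exists h.
  have L0 : 0 < 7 * 2 ^+ k :> R by rewrite mulr_gt0// exprn_gt0.
  have [s s1 hs] := balanced_substitute (side_gt0 k) (amplitude_ge0 k) L0 (family_bound k) hb.
  exists (substitute (side k) s h) => _; split; last by exists s.
  by rewrite sideS amplitudeS.
pose g := fix g k := if k is k'.+1 then F (k', g k') else fun _ _ => false.
have hg k : balanced (side k) (amplitude k) (g k).
  by elim: k => [|k IH]; [exact: balanced0 | exact: (hF (k, g k) IH).1].
by exists g; split=> // k; exact: (hF (k, g k) (hg k)).2.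
Qed.

End Tower.

(** * Extension to the whole plane *)

Section Coloring.
Variables (g : nat -> nat -> nat -> bool).
Hypothesis gS : forall k,
  exists2 s, s 1%N 1%N = false & g k.+1 = substitute (side k) s (g k).

(* The central block of level [k] is [[- offset k, side k - offset k)]; it is
   the sub-block (1, 1) of the central block of level [k.+1], so these blocks
   exhaust the plane. *)
Definition offset (k : nat) : nat := \sum_(j < k) side j.

Lemma offsetS k : offset k.+1 = (side k + offset k)%N.
Proof. by rewrite /offset big_ord_recr /= addnC. Qed.

(** Both sides of the central block recede from the origin at least linearly in [k], whence
    [centralP]. *)
Lemma offset_bounds k : (k <= offset k)%N /\ (offset k + k < side k)%N.
Proof.
elim: k => [|k [IH1 IH2]]; first by rewrite /offset big_ord0.
by have := side_ge4 k; rewrite offsetS sideS; split; nia.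
Qed.

Definition central (k : nat) (x : int) : bool :=
  0 <= x + (offset k)%:Z < (side k)%:Z.

Lemma centralP (k : nat) (x : int) : (absz x < k)%N -> central k x.
Proof. by have := offset_bounds k; rewrite /central; lia. Qed.

Definition level_coloring (k : nat) (x y : int) : bool :=
  g k (absz (x + (offset k)%:Z)) (absz (y + (offset k)%:Z)).

Lemma level_coloringS k x y : central k x -> central k y ->
  central k.+1 x /\ level_coloring k.+1 x y = level_coloring k x y.
Proof.
rewrite /central /level_coloring offsetS sideS => xk yk.
split; first by have := side_ge4 k; nia.
have h (z : int) : 0 <= z + (offset k)%:Z < (side k)%:Z ->
    absz (z + (side k + offset k)%N) = (1 * side k + absz (z + offset k)%R)%N by lia.
have [s s1 ->] := gS k.
rewrite (h x)// (h y)// substituteE ?s1//; lia.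
Qed.

Lemma level_coloring_le j k x y : (k <= j)%N -> central k x -> central k y ->
  level_coloring j x y = level_coloring k x y.
Proof.
move=> kj xk yk.
suff [_ _ //] : [/\ central j x, central j y & level_coloring j x y = level_coloring k x y].
rewrite -(subnKC kj); elim: (j - k)%N => [|d [IH1 IH2 IH3]]; rewrite ?addn0// addnS.
have [h1 h2] := level_coloringS IH1 IH2; have [h3 _] := level_coloringS IH2 IH1.
by split; rewrite // h2.
Qed.

(** The level is large enough for [centralP] to apply to both coordinates; by [coloringE] every
    level whose central block contains the point gives the same value. *)
Definition coloring (x y : int) : bool := level_coloring (absz x + absz y).+1 x y.

Lemma coloringE k x y : central k x -> central k y ->
  coloring x y = level_coloring k x y.
Proof.
move=> xk yk; rewrite /coloring; set K := (_ + _).+1.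
rewrite -(@level_coloring_le (maxn K k) K) ?leq_maxl//.
- by rewrite (@level_coloring_le (maxn K k) k) ?leq_maxr.
- by apply: centralP; rewrite ltnS leq_addr.
- by apply: centralP; rewrite ltnS leq_addl.
Qed.

(** Induction on [j - k]: a block of level [k + d] is a [c] by [c] array of blocks of level [k], so
    [U %/ c] locates the larger block and [U %% c] the place inside it. The signs met on the way
    down combine into [e]. *)
Lemma tower_block j k U V : (k <= j)%N ->
  (U.+1 * side k <= side j)%N -> (V.+1 * side k <= side j)%N ->
  exists e, forall u v, (u < side k)%N -> (v < side k)%N ->
  g j (U * side k + u) (V * side k + v) = e (+) g k u v.
Proof.
move=> kj; have k0 := side_gt0 k.
rewrite -(subnKC kj); elim: (j - k)%N U V => [|d IH] U V.
  rewrite addn0 -[X in (_ <= X)%N]mul1n => Uk.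
  rewrite -[X in (_ <= X)%N]mul1n => Vk.
  have -> : U = 0%N by rewrite leq_pmul2r// in Uk; lia.
  have -> : V = 0%N by rewrite leq_pmul2r// in Vk; lia.
  by exists false.
have [c hc] : exists c, side (k + d) = (c * side k)%N.
  exists (4 ^ (2 ^ (k + d) - 2 ^ k))%N; rewrite -expnD subnK//.
  by rewrite leq_exp2l// leq_addr.
have c0 : (0 < c)%N by have := side_gt0 (k + d); rewrite hc muln_gt0 => /andP[].
move=> _ _.
have [||e he] := IH (U %% c)%N (V %% c)%N.
- by rewrite hc leq_mul2r ltn_pmod// orbT.
- by rewrite hc leq_mul2r ltn_pmod// orbT.
have [s _ hs] := gS (k + d).
exists (s (U %/ c) (V %/ c) (+) e)%N => u v uk vk.
have dec W w : (W * side k + w =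
    (W %/ c) * side (k + d) + ((W %% c) * side k + w))%N.
  by rewrite {1}(divn_eq W c) hc mulnDl mulnA addnA.
have lt W w : (w < side k -> (W %% c) * side k + w < side (k + d))%N.
  move=> wk; rewrite hc; have := ltn_pmod W c0; nia.
by rewrite addnS hs (dec U) (dec V) substituteE ?lt// he// addbA.
Qed.

Lemma coloring_block k (X Y : int) : exists e, forall u v : nat,
  (u < side k)%N -> (v < side k)%N ->
  coloring (X * (side k)%:Z - (offset k)%:Z + u%:Z) (Y * (side k)%:Z - (offset k)%:Z + v%:Z)
    = e (+) g k u v.
Proof.
pose a (Z : int) := Z * (side k)%:Z - (offset k)%:Z.
pose j := (k + (absz (a X) + absz (a Y) + side k))%N.
have aj Z (w : nat) : (absz (a Z) + w < j)%N -> central j (a Z + w%:Z).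
  by move=> h; apply: centralP; lia.
(* The grids of levels [k] and [j] are aligned: the offsets differ by a sum of sides of levels at
   least [k], all multiples of [side k]. *)
have [q hq] : exists q, offset j = (offset k + q * side k)%N.
  rewrite /j; elim: (_ + side k)%N => [|d [q IH]]; first by exists 0%N; rewrite addn0 addn0.
  exists (q + 4 ^ (2 ^ (k + d) - 2 ^ k))%N.
  rewrite addnS offsetS IH mulnDl -expnD subnK ?leq_exp2l// ?leq_addr//.
  by rewrite addnC addnA.
have k0 := side_gt0 k.
have pos Z : central j (a Z + 0%:Z) -> central j (a Z + (side k).-1%:Z) ->
    exists2 U : nat, Z + q%:Z = U%:Z & (U.+1 * side k <= side j)%N.
  rewrite /central hq /a => h1 h2.
  have Zq : 0 <= Z + q%:Z.
    rewrite leNgt; apply/negP => h.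
    have : (Z + q%:Z + 1) * (side k)%:Z <= 0 by rewrite mulr_le0_ge0//; lia.
    nia.
  exists (absz (Z + q%:Z)); first by lia.
  have e : (absz (Z + q%:Z))%:Z = Z + q%:Z by lia.
  by move: h2; nia.
have [U hU Uj] : exists2 U : nat, X + q%:Z = U%:Z & (U.+1 * side k <= side j)%N.
  by apply: pos; apply: aj; rewrite /j; lia.
have [V hV Vj] : exists2 U : nat, Y + q%:Z = U%:Z & (U.+1 * side k <= side j)%N.
  by apply: pos; apply: aj; rewrite /j; lia.
have [|e he] := @tower_block j k U V _ Uj Vj; first by rewrite /j leq_addr.
exists e => u v uk vk.
rewrite (@coloringE j); [|apply: aj; rewrite /j; lia ..].
rewrite -he//; congr (g j _ _).
  by rewrite hq; have := congr1 (fun z => z * (side k)%:Z) hU; nia.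
by rewrite hq; have := congr1 (fun z => z * (side k)%:Z) hV; nia.
Qed.

End Coloring.

(** * Sums along digitized lines *)

Section Paths.
Variables (R : realType) (g : nat -> nat -> nat -> bool).
Hypothesis gS : forall k,
  exists2 s, s 1%N 1%N = false & g k.+1 = substitute (side k) s (g k).
Hypothesis hb : forall k, balanced (side k) (amplitude R k) (g k).
Let coloring := coloring g.

Lemma sum_window (a x : int) (N : nat) (h : int -> R) :
  \sum_(u < N) (a + u%:Z == x)%R%:R * h (a + u%:Z)%R = (a <= x < a + N%:Z)%R%:R * h x.
Proof.
have [xa|xa] := boolP (a <= x < a + N%:Z); last first.
  rewrite mul0r big1// => u _; case: eqP => [e|]; last by rewrite mul0r.
  by have := ltn_ord u; lia.
have uN : (absz (x - a)%R < N)%N by lia.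
have e : a + (Ordinal uN)%:Z = x by rewrite /=; lia.
rewrite (bigD1 (Ordinal uN))//= [X in _ + X]big1 ?addr0; first by rewrite e eqxx.
move=> u /eqP hu; case: eqP => [e'|]; last by rewrite mul0r.
by case: hu; apply: val_inj => /=; lia.
Qed.

Definition corner (k : nat) (X : int) : int := X * (side k)%:Z - (offset k)%:Z.

Section OnePath.
Variables (k n : nat) (zx zy : nat -> int) (D : int -> int -> bool).
(** With both coordinates of the path abstract, lines over either axis are treated at once. *)
Hypothesis Dpath : forall x y,
  (D x y)%:R = \sum_(i < n) (x == zx i)%:R * (y == zy i)%:R :> R.

Lemma sum_path_window (a b : int) (N : nat) (W : int -> int -> R) :
  \sum_(u < N) \sum_(v < N) (D (a + u%:Z) (b + v%:Z))%:R * W (a + u%:Z) (b + v%:Z) =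
  \sum_(i < n) (a <= zx i < a + N%:Z)%R%:R * (b <= zy i < b + N%:Z)%R%:R * W (zx i) (zy i).
Proof.
under eq_bigr do under eq_bigr do rewrite Dpath mulr_suml.
under eq_bigr do rewrite exchange_big.
rewrite exchange_big; apply: eq_bigr => i _ /=.
rewrite -mulrA -(sum_window b _ _ (fun y => W (zx i) y)).
rewrite -(sum_window a _ _ (fun x => \sum_(u < N) (b + u%:Z == zy i)%R%:R * W x (b + u%:Z))).
apply: eq_bigr => u _; rewrite mulr_sumr; apply: eq_bigr => v _.
by rewrite mulrA.
Qed.

Hypothesis Ddig : digital R D.

(** By [coloring_block] the block is a signed copy of [g k], so [hb] applies to the translated line,
    which has at most [n] points in the block. *)
Lemma path_block (X Y : int) :
  `|\sum_(i < n) (corner k X <= zx i < corner k X + (side k)%:Z)%R%:R *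
      (corner k Y <= zy i < corner k Y + (side k)%:Z)%R%:R
      * (-1) ^+ coloring (zx i) (zy i)| <= amplitude R k * Num.sqrt n%:R.
Proof.
set a := corner k X; set b := corner k Y.
rewrite -(sum_path_window a b (side k) (fun x y => (-1) ^+ coloring x y)).
have [e he] := coloring_block gS k X Y; rewrite -/(corner k X) -/(corner k Y) -/a -/b in he.
have -> : \sum_(u < side k) \sum_(v < side k)
      (D (a + u%:Z) (b + v%:Z))%:R * (-1) ^+ coloring (a + u%:Z) (b + v%:Z) =
    (-1) ^+ e * \sum_(u < side k) \sum_(v < side k)
      (D (a + u%:Z) (b + v%:Z))%:R * (-1) ^+ g k u v :> R.
  rewrite mulr_sumr; apply: eq_bigr => u _; rewrite mulr_sumr; apply: eq_bigr => v _.
  by rewrite /coloring he// signr_addb mulrCA.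
rewrite normrM normr_sign mul1r.
have h := hb k (digital_translate a b Ddig). apply: le_trans h _.
rewrite ler_wpM2l ?amplitude_ge0// ler_wsqrtr//.
have := sum_path_window a b (side k) (fun _ _ => 1).
under eq_bigr do under eq_bigr do rewrite mulr1.
move=> ->; apply: (@le_trans _ _ (\sum_(i < n) 1)); last first.
  by rewrite sumr_const card_ord.
apply: ler_sum => i _; rewrite mulr1.
by case: (_ <= _ < _); case: (_ <= _ < _); rewrite ?mulr0 ?mul0r ?mulr1.
Qed.

(** Take for [X] the block index of the least value; the other values are less than one side
    further. *)
Lemma path_start (z : nat -> int) : (0 < n)%N ->
  (forall i j, (i < n)%N -> (j < n)%N -> z i < z j + (side k)%:Z) ->
  exists X : int, forall i, (i < n)%N ->
    corner k X <= z i < corner k X + 2 * (side k)%:Z.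
Proof.
move=> n0 hz; have k0 := side_gt0 k.
have [i0 _ hmin] := @arg_minP _ _ _ (Ordinal n0) predT (fun i : 'I_n => z i) isT.
exists ((z i0 + (offset k)%:Z) %/ (side k)%:Z)%Z => i iN; rewrite /corner.
have h1 : z i0 <= z i := hmin (Ordinal iN) isT.
have h2 := hz i i0 iN (ltn_ord i0).
have := divz_eq (z i0 + (offset k)%:Z) (side k)%:Z.
have k0' : 0 < (side k)%:Z by lia.
have := ltz_pmod (z i0 + (offset k)%:Z) k0'.
have := modz_ge0 (z i0 + (offset k)%:Z) (lt0r_neq0 k0').
by lia.
Qed.

(* Such a path meets at most [2 * 2] blocks of level [k]. *)
Lemma path_bound : (0 < n)%N ->
  (forall i j, (i < n)%N -> (j < n)%N -> zx i < zx j + (side k)%:Z) ->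
  (forall i j, (i < n)%N -> (j < n)%N -> zy i < zy j + (side k)%:Z) ->
  `|\sum_(i < n) (-1) ^+ coloring (zx i) (zy i)| <= 4 * amplitude R k * Num.sqrt n%:R.
Proof.
move=> n0 hx hy.
have [X hX] := path_start n0 hx; have [Y hY] := path_start n0 hy.
pose w (Z z : int) : R := (corner k Z <= z < corner k Z + (side k)%:Z)%R%:R.
have cover Z z : corner k Z <= z < corner k Z + 2 * (side k)%:Z -> w Z z + w (Z + 1) z = 1.
  have e : corner k (Z + 1) = corner k Z + (side k)%:Z by rewrite /corner; ring.
  rewrite /w e; move: (corner k Z) (side k)%:Z => a s h.
  have [h1|h1] := ltP z (a + s).
    have -> : a <= z by lia.
    by rewrite addr0.
  rewrite andbF add0r /=.
  by have -> : z < a + s + s by lia.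
pose S X Y : R := \sum_(i < n) w X (zx i) * w Y (zy i) * (-1) ^+ coloring (zx i) (zy i).
have -> : \sum_(i < n) (-1) ^+ coloring (zx i) (zy i) =
    (S X Y + S X (Y + 1)) + (S (X + 1) Y + S (X + 1) (Y + 1)).
  rewrite /S -!big_split /=; apply: eq_bigr => i _.
  rewrite -!mulrDl -!mulrDr -!mulrDl !cover ?mul1r//; [exact: hY | exact: hX].
have hS X' Y' : `|S X' Y'| <= amplitude R k * Num.sqrt n%:R by exact: path_block.
have := hS X Y; have := hS (X + 1) Y; have := hS X (Y + 1); have := hS (X + 1) (Y + 1).
set s1 := S _ _; set s2 := S _ _; set s3 := S _ _; set s4 := S _ _.
rewrite -mulrA; move: (amplitude R k * _) => B.
by rewrite !ler_norml; lra.
Qed.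

End OnePath.

Definition digital_height (m c : R) (x : int) : int := Num.floor (m * x%:~R + c).

Lemma digital_lineE (m c : R) (p : int) (n : nat) (x y : int) :
  (digital_line m c p (p + n%:Z) x y)%:R =
    \sum_(i < n) (x == p + i%:Z)%R%:R * (y == digital_height m c (p + i%:Z))%:R :> R.
Proof.
have := sum_window p x n (fun x => (y == digital_height m c x)%:R).
rewrite -natrM mulnb => <-; apply: eq_bigr => i _; by rewrite eq_sym.
Qed.

Lemma digital_height_lt (m c : R) (p : int) (n i j : nat) : `|m| <= 1 ->
  (i < n)%N -> (j < n)%N ->
  digital_height m c (p + i%:Z) < digital_height m c (p + j%:Z) + n%:Z.
Proof.
move=> m1 iN jN; rewrite /digital_height.
set s := Num.floor _; set t := Num.floor _.
have h1 : s%:~R <= m * (p + i%:Z)%:~R + c by exact: floor_le.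
have h2 : m * (p + j%:Z)%:~R + c < (t + 1)%:~R by exact: floorD1_gt.
have : (i%:Z - j%:Z)%:~R * m <= (n%:Z - 1)%:~R.
  apply: le_trans (ler_norm _) _; rewrite normrM -[leRHS]mulr1 ler_pM//.
  by rewrite -intr_norm ler_int; lia.
rewrite -(ltr_int R) !intrD !intrN -!pmulrn in h1 h2 * => h.
by lra.
Qed.

Lemma digital_sum_bound (m c : R) (p : int) (k n : nat) :
  `|m| <= 1 -> (n <= side k)%N ->
  `|\sum_(i < n) (-1) ^+ coloring (p + i%:Z) (digital_height m c (p + i%:Z))|
      <= 4 * amplitude R k * Num.sqrt n%:R /\
  `|\sum_(i < n) (-1) ^+ coloring (digital_height m c (p + i%:Z)) (p + i%:Z)|
      <= 4 * amplitude R k * Num.sqrt n%:R.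
Proof.
move=> m1 nk.
have [->|n0] := posnP n.
  by rewrite !big_ord0 normr0 sqrtr0 mulr0.
have hx (i j : nat) : (i < n)%N -> (j < n)%N -> p + i%:Z < p + j%:Z + (side k)%:Z by lia.
have hy (i j : nat) : (i < n)%N -> (j < n)%N ->
    digital_height m c (p + i%:Z) < digital_height m c (p + j%:Z) + (side k)%:Z.
  by move=> iN jN; have := digital_height_lt c p m1 iN jN; lia.
split.
  apply: (@path_bound k n (fun i => p + i%:Z) (fun i => digital_height m c (p + i%:Z))
    (digital_line m c p (p + n%:Z))) => //.
    by move=> x y; exact: digital_lineE.
  by exists m, c, p, (p + n%:Z); split=> //; left.
apply: (@path_bound k n (fun i => digital_height m c (p + i%:Z)) (fun i => p + i%:Z)
    (fun x y => digital_line m c p (p + n%:Z) y x)) => //.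
  by move=> x y; rewrite digital_lineE; apply: eq_bigr => i _; rewrite mulrC.
by exists m, c, p, (p + n%:Z); split=> //; right.
Qed.

End Paths.

(** * Growth of the amplitudes *)

Section Growth.
Variable R : realType.

(** The right side is [expR x] with [x = eps * ln 4 * 2 ^+ k], and [expR x >= x ^+ 2 / 2] is
    quadratic in [2 ^+ k]. The threshold 84 is twice [21 * 2]. *)
Lemma powR_side_gt (eps : R) : 0 < eps ->
  exists K, forall k, (K <= k)%N -> 21 * 2 ^+ k.+1 <= (side k)%:R `^ eps.
Proof.
move=> e0.
have l0 : 0 < ln 4 :> R by rewrite ln_gt0// ltr1n.
pose d := (eps * ln 4) ^+ 2.
have d0 : 0 < d by rewrite exprn_gt0// mulr_gt0.
exists (Num.bound (84 / d)) => k hk.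
have h1 : 84 <= d * 2 ^+ k.
  rewrite mulrC -ler_pdivrMr//; apply: (@le_trans _ _ (Num.bound (84 / d))%:R).
    by apply/ltW/archi_boundP; rewrite divr_ge0// ltW.
  rewrite -natrX ler_nat; apply: leq_trans hk _; exact/ltnW/ltn_expl.
have -> : (side k)%:R `^ eps = expR (eps * ln 4 * 2 ^+ k).
  rewrite /powR pnatr_eq0 expn_eq0 /= /side natrX lnXn//.
  by rewrite -[ln 4 *+ _]mulr_natl natrX; congr expR; ring.
have x0 : 0 <= eps * ln 4 * 2 ^+ k by rewrite !mulr_ge0// ?exprn_ge0// ltW.
apply: le_trans (expR_ge1Dxn 1 x0).
have -> : (eps * ln 4 * 2 ^+ k) ^+ 2 = (d * 2 ^+ k) * 2 ^+ k by rewrite /d; ring.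
rewrite exprS -[2`!%:R]/(2 : R).
have : 0 <= 2 ^+ k :> R by rewrite exprn_ge0.
by nra.
Qed.

Lemma amplitude_growth (eps : R) : 0 < eps ->
  exists2 C, 0 <= C & forall k, amplitude R k.+1 <= C * (side k)%:R `^ eps.
Proof.
move=> e0; have [K hK] := powR_side_gt e0.
have p0 k : 0 < (side k)%:R `^ eps :> R by rewrite powR_gt0// ltr0n side_gt0.
pose u k := amplitude R k.+1 / (side k)%:R `^ eps.
have u0 k : 0 <= u k by rewrite divr_ge0 ?amplitude_ge0// ltW.
exists (\sum_(j < K.+1) u j); first by apply: sumr_ge0.
suff h k : u k <= \sum_(j < K.+1) u j by move=> k; rewrite -ler_pdivrMr//; exact: h.
have small k' : (k' <= K)%N -> u k' <= \sum_(j < K.+1) u j.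
  by move=> kK; rewrite (bigD1 (Ordinal (kK : k' < K.+1)%N))//= lerDl sumr_ge0.
elim: k => [|k IH]; first exact: small.
have [kK|kK] := ltnP k K; first exact: small.
apply: le_trans IH; rewrite /u amplitudeS sideS natrM powRM//.
have := hK k kK; have := p0 k; set q := _ `^ eps => q0 hq.
rewrite ler_pdivrMr ?mulr_gt0//.
have -> : amplitude R k.+1 / q * (q * q) = amplitude R k.+1 * q.
  by field; rewrite gt_eqF.
by rewrite ler_wpM2l ?amplitude_ge0//; lra.
Qed.

Lemma exists_coloring : exists s : int -> int -> bool,
  forall eps : R, 0 < eps -> exists2 C, 0 <= C &
  forall (m c : R) (p : int) (n : nat), `|m| <= 1 -> (0 < n)%N ->
  `|\sum_(i < n) (-1) ^+ s (p + i%:Z) (digital_height m c (p + i%:Z))|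
      <= C * n%:R `^ (2^-1 + eps) /\
  `|\sum_(i < n) (-1) ^+ s (digital_height m c (p + i%:Z)) (p + i%:Z)|
      <= C * n%:R `^ (2^-1 + eps).
Proof.
have [g [hb gS]] := exists_tower R.
exists (coloring g) => eps e0.
have [C C0 hC] := amplitude_growth e0.
(* With [k] the least level such that [n <= side k], the 16 covers [k = 0]; otherwise
   [side k.-1 < n] and [4 * C] comes from [amplitude_growth]. *)
exists (16 + 4 * C) => [|m c p n m1 n0]; first by rewrite addr_ge0// mulr_ge0.
have n1 : 1 <= n%:R :> R by rewrite ler1n.
have [k nk hk] : exists2 k, (n <= side k)%N &
    4 * amplitude R k <= (16 + 4 * C) * n%:R `^ eps.
  have exk : exists k, (n <= side k)%N.
    by exists n; have := offset_bounds n; lia.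
  have ne1 : 1 <= n%:R `^ eps by have := ler_powR n1 (ltW e0); rewrite powRr0.
  case: (ex_minnP exk) => -[|k] nk kmin.
    exists 0%N => //; rewrite /amplitude big_ord0 mulr1.
    by have : 0 <= C * n%:R `^ eps by [rewrite mulr_ge0// powR_ge0]; lra.
  exists k.+1 => //.
  have kn : (side k < n)%N by rewrite ltnNge; apply/negP => /kmin; rewrite ltnn.
  have h : (side k)%:R `^ eps <= n%:R `^ eps.
    by apply: ge0_ler_powR; rewrite ?nnegrE// ?ltW// ltr_nat.
  have := hC k; have := ler_wpM2l C0 h; lra.
have bound : 4 * amplitude R k * Num.sqrt n%:R <=
    (16 + 4 * C) * n%:R `^ (2^-1 + eps).
  rewrite powRD; last by apply/implyP; rewrite pnatr_eq0; lia.
  rewrite powR12_sqrt// mulrCA [leRHS]mulrC -[leRHS]mulrA.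
  by rewrite [leRHS]mulrC [X in _ <= X * _]mulrC ler_wpM2r// mulrC.
have [h1 h2] := digital_sum_bound gS hb c p m1 nk.
by split; [apply: le_trans h1 bound | apply: le_trans h2 bound].
Qed.

End Growth.

(** * Integrals along segments *)

Section Averaging.
Variable R : realType.
Notation mu := (@lebesgue_measure R).

Lemma bounded_integrable_itv (g : R -> R) (M : R) (i : interval R) :
  measurable_fun [set: R] g -> (forall x, `|g x| <= M) ->
  (mu [set` i] < +oo)%E -> mu.-integrable [set` i] (EFin \o g).
Proof.
move=> mg gM fin; apply: measurable_bounded_integrable => //.
  exact: measurable_funTS.
exists M; split; first exact: num_real.
by move=> y My x _ /=; apply: le_trans (gM x) _; exact: ltW.
Qed.

Lemma lebesgue_measure_itvco_lty (a b : R) : (mu `[a, b[ < +oo)%E.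
Proof. by rewrite lebesgue_measure_itv/=; case: ifP => _; rewrite ?ltry// -EFinB ltry. Qed.

Lemma lebesgue_measure_translate (c : R) (A : set R) : measurable A ->
  pushforward mu ((fun x => x + c) : measurableTypeR R -> measurableTypeR R) A = mu A.
Proof.
move=> mA; apply/esym/lebesgue_measure_unique => //= [|_ _ [[a b]] _ <-].
  exact: measurable_funD.
rewrite /pushforward.
have -> : (fun x => x + c) @^-1` `]a, b]%classic = `]a - c, b - c]%classic.
  by apply/seteqP; split => x /=; rewrite !in_itv /= ltrBlDr lerBrDr.
rewrite !lebesgue_measure_itv/= !lte_fin ltrD2r.
by case: ifP => // _; rewrite -!EFinB; congr EFin; ring.
Qed.

Lemma Rintegral_translate (g : R -> R) (M a b c : R) :
  measurable_fun [set: R] g -> (forall x, `|g x| <= M) ->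
  \int[mu]_(x in `[a + c, b + c[) g x = \int[mu]_(x in `[a, b[) g (x + c).
Proof.
move=> mg gM; rewrite /Rintegral; congr fine.
have pre : (fun x => x + c) @^-1` `[a + c, b + c[%classic = `[a, b[%classic.
  by apply/seteqP; split => x /=; rewrite !in_itv /= lerD2r ltrD2r.
have mc : measurable_fun [set: R] (fun x : R => x + c) by exact: measurable_funD.
rewrite -(@eq_measure_integral _ _ _ _ mu
  (pushforward mu ((fun x => x + c) : measurableTypeR R -> measurableTypeR R))); last first.
  by move=> A mA _; exact: lebesgue_measure_translate.
rewrite integral_pushforward//; first by rewrite pre.
  exact/measurable_EFinP.
rewrite pre; apply: (@bounded_integrable_itv (fun x => g (x + c)) M) => //.
  exact: measurableT_comp.
exact: lebesgue_measure_itvco_lty.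
Qed.

Lemma Rintegral_itvco_cat (g : R -> R) (M a b c : R) :
  measurable_fun [set: R] g -> (forall x, `|g x| <= M) -> a <= b -> b <= c ->
  \int[mu]_(x in `[a, c[) g x = \int[mu]_(x in `[a, b[) g x + \int[mu]_(x in `[b, c[) g x.
Proof.
move=> mg gM ab bc.
have e : `[a, c[%classic = `[a, b[%classic `|` `[b, c[%classic.
  by rewrite -itv_bndbnd_setU// bnd_simp.
rewrite e Rintegral_setU//.
  rewrite -e; apply: (bounded_integrable_itv mg gM); exact: lebesgue_measure_itvco_lty.
apply/disj_setPS => y [/=]; rewrite !in_itv/= => /andP[_ yx] /andP[].
by rewrite leNgt yx.
Qed.

(** Half-open intervals make the translates of [[0, h)] tile [[0, n h)] exactly. *)
Lemma Rintegral_fold (g : R -> R) (M h : R) (n : nat) :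
  measurable_fun [set: R] g -> (forall x, `|g x| <= M) -> 0 <= h ->
  \int[mu]_(x in `[0, n%:R * h[) g x =
    \int[mu]_(x in `[0, h[) (\sum_(i < n) g (x + i%:R * h)).
Proof.
move=> mg gM h0.
have mgi (i : nat) : measurable_fun [set: R] (fun x => g (x + i%:R * h)).
  by apply: measurableT_comp => //; exact: measurable_funD.
have gMi (i : nat) x : `|g (x + i%:R * h)| <= M by exact: gM.
elim: n => [|n IH].
  rewrite mul0r set_itv_ge ?bnd_simp ?ltxx// Rintegral_set0.
  under eq_Rintegral do rewrite big_ord0.
  by rewrite Rintegral_cst// mul0r.
have nh : 0 <= n%:R * h by rewrite mulr_ge0.
have e : n.+1%:R * h = h + n%:R * h by rewrite -natr1; ring.
rewrite (Rintegral_itvco_cat mg gM nh); last by rewrite e lerDr.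
rewrite IH e -[X in `[X, _[](add0r (n%:R * h)) (Rintegral_translate _ _ _ mg gM).
under [RHS]eq_Rintegral do rewrite big_ord_recr.
rewrite RintegralD//.
  apply: (@bounded_integrable_itv _ (\sum_(i < n) M)).
  - exact: measurable_sum.
  - by move=> x; apply: le_trans (ler_norm_sum _ _ _) _; apply: ler_sum => i _.
  - exact: lebesgue_measure_itvco_lty.
exact: (bounded_integrable_itv (mgi n) (gMi n) (lebesgue_measure_itvco_lty _ _)).
Qed.

Lemma norm_Rintegral_itvco_le (g : R -> R) (B a b : R) :
  measurable_fun [set: R] g -> (forall x, `|g x| <= B) -> a <= b ->
  `|\int[mu]_(x in `[a, b[) g x| <= B * (b - a).
Proof.
move=> mg gB ab.
have fin := lebesgue_measure_itvco_lty a b.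
apply: le_trans (le_normr_Rintegral _ _) _ => //.
  exact: (bounded_integrable_itv mg gB).
have -> : B * (b - a) = \int[mu]_(x in `[a, b[) B.
  rewrite Rintegral_cst//; congr (_ * _).
  rewrite /= lebesgue_measure_itv/= lte_fin.
  by case: ltP => // ba; rewrite (le_anti (_ : a <= b <= a)) ?ab// subrr.
apply: le_Rintegral => //.
- apply: (@bounded_integrable_itv (fun x => `|g x|) B) => //.
    exact: measurableT_comp.
  by move=> x; rewrite normr_id.
- by apply: (@bounded_integrable_itv (fun _ => B) `|B|).
Qed.

(** Folding controls [[0, n h)] by [B * h]; the remainder [[n h, 1)] has length at most [h]. *)
Lemma norm_Rintegral_average (g : R -> R) (h B : R) (n : nat) :
  measurable_fun [set: R] g -> (forall x, `|g x| <= 1) -> 0 <= h ->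
  n%:R * h <= 1 <= n.+1%:R * h ->
  (forall x, `|\sum_(i < n) g (x + i%:R * h)| <= B) ->
  `|\int[mu]_(x in `[0, 1]) g x| <= (B + 1) * h.
Proof.
move=> mg g1 h0 /andP[nh nSh] hB.
have fin := lebesgue_measure_itvco_lty 0 1.
rewrite -Rintegral_itv_bndo_bndc; last exact: (bounded_integrable_itv mg g1).
rewrite (Rintegral_itvco_cat mg g1 _ nh) ?mulr_ge0//.
apply: le_trans (ler_normD _ _) _; rewrite mulrDl; apply: lerD.
  rewrite (Rintegral_fold _ mg g1 h0) -[X in _ * X]subr0.
  apply: norm_Rintegral_itvco_le => //.
  by apply: measurable_sum => i; apply: measurableT_comp => //; exact: measurable_funD.
apply: le_trans (norm_Rintegral_itvco_le mg g1 nh) _.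
by rewrite ler_wpM2l//; rewrite -natr1 in nSh; lra.
Qed.

End Averaging.

(** * From segments to digitized lines *)

Section Segments.
Variable R : realType.
Notation mu := (@lebesgue_measure R).

(** For arbitrary [s], the set where the sign is -1 is a countable union over pairs of integers. *)
Lemma measurable_sign_floor (s : int -> int -> bool) (x y : R -> R) :
  measurable_fun [set: R] x -> measurable_fun [set: R] y ->
  measurable_fun [set: R]
    (fun t => (-1) ^+ s (Num.floor (x t)) (Num.floor (y t)) : R).
Proof.
move=> mx my.
have -> : (fun t => (-1) ^+ s (Num.floor (x t)) (Num.floor (y t)) : R) =
    fun t => if s (Num.floor (x t)) (Num.floor (y t)) then -1 else 1.
  by apply/funext => t; case: s; rewrite ?expr1 ?expr0.
apply: measurable_fun_ifT => //; apply: (@measurable_fun_bool _ _ _ _ true).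
have mfloor (z : R -> R) (i : int) : measurable_fun [set: R] z ->
    measurable [set t | Num.floor (z t) = i].
  move=> mz.
  have -> : [set t | Num.floor (z t) = i] = z @^-1` `[i%:~R, (i + 1)%:~R[%classic.
    apply/seteqP; split => t /=; rewrite in_itv /=.
      by move=> <-; exact: floor_itv.
    by move=> h; apply: floor_def.
  by rewrite -[X in measurable X]setTI; apply: mz.
have -> : [set: R] `&` (fun t => s (Num.floor (x t)) (Num.floor (y t))) @^-1` [set true] =
    \bigcup_(ij : int * int) (if s ij.1 ij.2 then
      [set t | Num.floor (x t) = ij.1] `&` [set t | Num.floor (y t) = ij.2] else set0).
  apply/seteqP; split => t /=.
    move=> [_ /= st]; exists (Num.floor (x t), Num.floor (y t)) => //=.
    by rewrite st.
  by move=> [[i j] _ /=]; case: ifP => //= sij [-> ->].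
apply: countable_bigcupT_measurable => // -[i j] /=.
by case: ifP => // _; apply: measurableI; exact: mfloor.
Qed.

Lemma sum_digital_reverse (W : int -> int -> R) (B : R) (m c : R) (n : nat) :
  (forall p, `|\sum_(i < n) W (p + i%:Z) (digital_height m c (p + i%:Z))| <= B) ->
  forall p, `|\sum_(i < n) W (p - i%:Z) (digital_height m c (p - i%:Z))| <= B.
Proof.
move=> h p; have := h (p - (n%:Z - 1)).
rewrite (reindex_inj rev_ord_inj) /=.
congr (`|_| <= _); apply: eq_bigr => i _.
by have -> : p - (n%:Z - 1) + (n - i.+1)%N%:Z = p - i%:Z by have := ltn_ord i; lia.
Qed.

(** A parameter step of [1 / |dx|] moves the abscissa by exactly 1 or -1, so the samples in the
    folded sum follow a digitized line, read backwards when [dx < 0]. *)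
Lemma norm_Rintegral_segment (s : int -> int -> bool) (K : R) (x0 y0 dx dy : R) :
  let n := Num.truncn `|dx| in
  (forall (m c : R) (p : int), `|m| <= 1 ->
    `|\sum_(i < n) (-1) ^+ s (p + i%:Z) (digital_height m c (p + i%:Z))| <= K) ->
  1 <= `|dx| -> `|dy| <= `|dx| ->
  `|\int[mu]_(t in `[0, 1])
     (-1) ^+ s (Num.floor (x0 + t * dx)) (Num.floor (y0 + t * dy))|
    <= (K + 1) / `|dx|.
Proof.
move=> n hK dx1 dyx.
have dx0 : 0 < `|dx| by exact: lt_le_trans dx1.
have dxN0 : dx != 0 by rewrite -normr_gt0.
have maff (a b : R) : measurable_fun [set: R] (fun t => a + t * b).
  by apply: measurable_funD => //; exact: measurable_funM.
apply: (@norm_Rintegral_average _ _ _ _ n).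
- by apply: measurable_sign_floor; exact: maff.
- by move=> t; rewrite normr_sign.
- by rewrite invr_ge0.
- rewrite ler_pdivrMr// ler_pdivlMr// !mul1r.
  by have /andP[-> /ltW ->] := truncn_itv (ltW dx0).
move=> t; pose p := Num.floor (x0 + t * dx); pose m := dy / dx.
(* The intercept makes the line take the height of the first sample at the integer [p], the floor of
   its abscissa. *)
pose c := y0 + t * dy - m * p%:~R.
have m1 : `|m| <= 1 by rewrite normrM normfV ler_pdivrMr// mul1r.
have fl (i : int) : Num.floor (x0 + t * dx + i%:~R) = p + i.
  by rewrite floorDrz ?intr_int// intrKfloor.
have gl (i : int) : Num.floor (y0 + t * dy + m * i%:~R) = digital_height m c (p + i).
  by rewrite /digital_height /c intrD; congr Num.floor; ring.
have [dxp|dxn] := ltP 0 dx.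
  rewrite (eq_bigr (fun i : 'I_n => (-1) ^+ s (p + i%:Z) (digital_height m c (p + i%:Z)))).
    exact: hK.
  move=> i _; rewrite -gl -fl.
  have -> : x0 + (t + i%:R / `|dx|) * dx = x0 + t * dx + i%:Z%:~R.
    by rewrite gtr0_norm// -pmulrn; field.
  have -> : y0 + (t + i%:R / `|dx|) * dy = y0 + t * dy + m * i%:Z%:~R.
    by rewrite gtr0_norm// -pmulrn /m; field.
  by [].
have {}dxn : dx < 0 by rewrite lt_neqAle dxN0.
rewrite (eq_bigr (fun i : 'I_n => (-1) ^+ s (p - i%:Z) (digital_height m c (p - i%:Z)))).
  apply: (@sum_digital_reverse (fun x y => (-1) ^+ s x y)) => q; exact: hK.
move=> i _; rewrite -gl -fl.
have -> : x0 + (t + i%:R / `|dx|) * dx = x0 + t * dx + (- i%:Z)%:~R.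
  by rewrite ltr0_norm// intrN -pmulrn; field.
have -> : y0 + (t + i%:R / `|dx|) * dy = y0 + t * dy + m * (- i%:Z)%:~R.
  by rewrite ltr0_norm// intrN -pmulrn /m; field.
by [].
Qed.

Lemma euclid_le_double (x y : R) : `|y| <= `|x| ->
  Num.sqrt (x ^+ 2 + y ^+ 2) <= 2 * `|x|.
Proof.
move=> yx; have -> : 2 * `|x| = Num.sqrt ((2 * x) ^+ 2).
  by rewrite sqrtr_sqr normrM ger0_norm.
apply: ler_wsqrtr; rewrite -[y ^+ 2]real_normK ?num_real//.
rewrite exprMn -[x ^+ 2]real_normK ?num_real//.
by have := normr_ge0 y; nra.
Qed.

(** The outer factor 2 is [l <= 2 * |dx|], and the number of samples satisfies [n <= |dx| <= l]. *)
Lemma coloring_segment (s : int -> int -> bool) (E C : R) : 0 <= C -> 0 <= E ->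
  (forall (m c : R) (p : int) (n : nat), `|m| <= 1 -> (0 < n)%N ->
    `|\sum_(i < n) (-1) ^+ s (p + i%:Z) (digital_height m c (p + i%:Z))|
      <= C * n%:R `^ E) ->
  forall (x0 y0 dx dy l : R), 1 <= `|dx| -> `|dy| <= `|dx| ->
  l = Num.sqrt (dx ^+ 2 + dy ^+ 2) ->
  l * `|\int[mu]_(t in `[0, 1])
     (-1) ^+ s (Num.floor (x0 + t * dx)) (Num.floor (y0 + t * dy))|
    <= 2 * (C * l `^ E + 1).
Proof.
move=> C0 E0 hC x0 y0 dx dy l dx1 dyx lE.
have dx0 : 0 < `|dx| by exact: lt_le_trans dx1.
have dxl : `|dx| <= l by rewrite lE -sqrtr_sqr ler_wsqrtr// lerDl sqr_ge0.
have ldx : l <= 2 * `|dx| by rewrite lE euclid_le_double.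
set n := Num.truncn `|dx|.
have /andP[nl nu] := truncn_itv (ltW dx0); rewrite -/n in nl nu.
have n0 : (0 < n)%N by rewrite truncn_gt0.
have hK (m c : R) (p : int) : `|m| <= 1 ->
    `|\sum_(i < n) (-1) ^+ s (p + i%:Z) (digital_height m c (p + i%:Z))| <= C * l `^ E.
  move=> m1; apply: le_trans (hC m c p n m1 n0) _; rewrite ler_wpM2l//.
  apply: ge0_ler_powR; rewrite ?nnegrE ?lE ?sqrtr_ge0//.
  by rewrite -lE; exact: le_trans nl dxl.
have l0 : 0 <= l by rewrite lE sqrtr_ge0.
have h := norm_Rintegral_segment x0 y0 hK dx1 dyx.
apply: le_trans (ler_wpM2l l0 h) _.
rewrite mulrA ler_pdivrMr// mulrAC ler_wpM2r//.
by rewrite addr_ge0// mulr_ge0// powR_ge0.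
Qed.

End Segments.

(** Inside a single cell the integral is plus or minus the length, so for [eps > 1/2] no constant
    can serve arbitrarily short segments; hence the alternative on [eps] and the length. *)
Theorem theorem2 (R : realType) :
  exists f : R * R -> R,
    checkerboard_coloring f /\
    forall eps : R, 0 < eps ->
      exists C : R, forall a b : R * R,
        (eps <= 2^-1 \/ 1 <= segment_length a b) ->
        `|segment_integral f a b| <= C * segment_length a b `^ (2^-1 + eps).
Proof.
have [s hs] := exists_coloring R.
pose f (q : R * R) : R := (-1) ^+ s (Num.floor q.1) (Num.floor q.2).
exists f; split.
  split=> [q|[i j] p q /= [p1 p2] [q1 q2]].
    by rewrite /f; case: (s _ _); [left; rewrite expr1 | right; rewrite expr0].
  have fl (x : R) (z : int) : z%:~R <= x < z%:~R + 1 -> Num.floor x = z.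
    by move=> h; apply: floor_def; rewrite intrD.
  by rewrite /f (fl _ _ p1) (fl _ _ p2) (fl _ _ q1) (fl _ _ q2).
move=> eps e0; have [C C0 hC] := hs eps e0.
set E := 2^-1 + eps in hC *.
have E0 : 0 < E by rewrite /E; lra.
(* For [l >= 1] the bound [2 * (C * l]^ E + 1)[is absorbed since]1 <= l [^ E]; the 2 also covers
   segments with both [|dx|] and [|dy|] below 1, where [l <= 2]. *)
exists (2 * C + 2) => a b heps.
set l := segment_length a b in heps *.
have l0 : 0 <= l by exact: sqrtr_ge0.
rewrite /segment_integral -/l normrM (ger0_norm l0).
set dx := b.1 - a.1; set dy := b.2 - a.2.
have le : l = Num.sqrt (dx ^+ 2 + dy ^+ 2) by [].
have mf : measurable_fun [set: R] (fun t => f (a.1 + t * dx, a.2 + t * dy)).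
  by apply: measurable_sign_floor; apply: measurable_funD => //; exact: measurable_funM.
have trivial : l * `|\int[lebesgue_measure]_(t in `[0, 1])
    f (a.1 + t * dx, a.2 + t * dy)| <= l.
  have f1 t : `|f (a.1 + t * dx, a.2 + t * dy)| <= 1 by rewrite normr_sign.
  have := norm_Rintegral_itvco_le mf f1 ler01.
  rewrite Rintegral_itv_bndo_bndc; last first.
    apply: (bounded_integrable_itv mf f1); exact: lebesgue_measure_itvco_lty.
  by rewrite mul1r subr0 => h; rewrite ler_piMr.
have [l1|l1] := ltP l 1.
  have e2 : eps <= 2^-1 by case: heps => //; rewrite leNgt l1.
  apply: le_trans trivial _.
  have [->|ln0] := eqVneq l 0; first by rewrite mulr_ge0 ?powR_ge0//; lra.
  (* Here [E <= 1] because [eps <= 1/2]. *)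
  have h : l <= l `^ E.
    apply: ger1_powR; last by rewrite /E; lra.
    by rewrite lt_neqAle eq_sym ln0 l0 ltW.
  by have := powR_ge0 l E; nra.
have lE : 1 <= l `^ E.
  by have := ler_powR l1 (ltW E0); rewrite powRr0.
have CE : C * l `^ E >= 0 by rewrite mulr_ge0// powR_ge0.
have short : l <= 2 -> l <= (2 * C + 2) * l `^ E by lra.
have [xy|yx] := leP `|dy| `|dx|.
  have [dx1|dx1] := leP 1 `|dx|; last first.
    apply: le_trans trivial (short _); rewrite le.
    by have := euclid_le_double xy; lra.
  have h := @coloring_segment R s E C C0 (ltW E0)
    (fun m c p n m1 n0 => (hC m c p n m1 n0).1) a.1 a.2 dx dy l dx1 xy le.
  apply: le_trans h _.
  by lra.
have {le}le : l = Num.sqrt (dy ^+ 2 + dx ^+ 2) by rewrite addrC.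
have [dy1|dy1] := leP 1 `|dy|; last first.
  apply: le_trans trivial (short _); rewrite le.
  by have := euclid_le_double (ltW yx); lra.
(* For steep segments the axes are exchanged and the coloring is transposed. *)
apply: le_trans (@coloring_segment R (fun x y => s y x) E C C0 (ltW E0)
  (fun m c p n m1 n0 => (hC m c p n m1 n0).2) a.2 a.1 dy dx l dy1 (ltW yx) le) _.
by lra.
Qed.
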